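(* Fix $\beta\in(0,1)$ and let $H=H(n,\beta)$ be a minimum-size hitting set of the random set system $R(n,p)$ generated when each set in $\mathcal{P}([n])$ is independently picked with probability $p=2^{-n\beta}$; write $|H|$ for its size. Let $\delta=\beta^{-\beta}(1-\beta)^{-(1-\beta)}$ and $\gamma=\max\{1,\frac{1-\beta}{\beta}\}$, let $\omega(n)\to\infty$ arbitrarily slowly (in particular $\ln\omega(n)=o(n)$), and define $$o_n=\lg\Big(n\ln\delta-\tfrac12\ln n+(\ln\gamma)(\lg n)+\ln\omega(n)\Big)-\lg(n\ln\delta),$$ so that $o_n=o(1)$ as $n\to\infty$. Then with probability tending to $1$ as $n\to\infty$, $|H|=h$ or $|H|=h+1$, where $$h=\big\lfloor(1-\beta)n-\lg(n\ln\delta)-o_n\big\rfloor+1.$$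
   Context: $[n]=\{1,2,\dots,n\}$, $\mathcal{P}([n])$ is its power set, $\lg=\log_2$, and $\ln$ is the natural logarithm. The random set system $R(n,p)$ is the random family $\mathcal{A}\subseteq\mathcal{P}([n])$ obtained by including each $A\in\mathcal{P}([n])$ independently with probability $p=p_n$. A set $S\subseteq[n]$ is a hitting set for $\mathcal{A}$ if $|A\cap S|\ge1$ for every $A\in\mathcal{A}$. $|H|$ is the minimum cardinality of a hitting set of $\mathcal{A}$; the event $|H|=k$ means that a hitting set of size $k$ exists and none of smaller size exists (if $\emptyset\in\mathcal A$ there is no hitting set and no such event occurs). *)

(* Defs.v *)
From HB Require Import structures.
From mathcomp Require Import all_boot all_order all_algebra.
From mathcomp Require Import all_classical all_reals all_analysis.

Set Implicit Arguments.
Unset Strict Implicit.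
Unset Printing Implicit Defensive.

Import Order.TTheory GRing.Theory Num.Theory.
Import numFieldNormedType.Exports.

Local Open Scope classical_set_scope.
Local Open Scope ring_scope.

(* The ground set [n] is 'I_n, so a set system is a {set {set 'I_n}}.  In
   R(n, p) the 2^n inclusion indicators are independent Bernoulli(p), hence the
   law of the random system is the product below. *)
Definition set_system_weight (R : realType) (n : nat) (p : R)
    (A : {set {set 'I_n}}) : R :=
  \prod_(B : {set 'I_n}) (if B \in A then p else 1 - p).

Definition set_system_prob (R : realType) (n : nat) (p : R)
    (E : pred {set {set 'I_n}}) : R :=
  \sum_(A : {set {set 'I_n}} | E A) set_system_weight p A.

Lemma set_system_prob_total (R : realType) (n : nat) (p : R) :
  set_system_prob p (fun _ : {set {set 'I_n}} => true) = 1.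
Proof.
rewrite /set_system_prob /set_system_weight -bigA_distr big1 // => B _.
by rewrite [LHS]addrC subrK.
Qed.

(* The probabilities of the events F `<=` A determine the law: the indicators are
   mutually independent with parameter p. *)
Lemma set_system_prob_include (R : realType) (n : nat) (p : R)
    (F : {set {set 'I_n}}) :
  set_system_prob p (fun A => F \subset A) = p ^+ #|F|.
Proof.
rewrite /set_system_prob /set_system_weight.
transitivity (\prod_(B : {set 'I_n}) (p + (if B \in F then 0 else 1 - p))).
  rewrite bigA_distr big_mkcond /=; apply: eq_bigr => A _.
  case: ifPn => [/fintype.subsetP FA | /fintype.subsetPn[B BF BA]].
    apply: eq_bigr => B _; case: ifPn => // BA.
    by case: ifPn => // /FA; rewrite (negbTE BA).
  by rewrite (bigD1 B) //= (negbTE BA) BF mul0r.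
rewrite (bigID (mem F)) /= [X in _ * X]big1 => [|B /negbTE ->].
  by rewrite mulr1 -prodr_const; apply: eq_bigr => B ->; rewrite addr0.
by rewrite [LHS]addrC subrK.
Qed.

Definition hitting_set (n : nat) (A : {set {set 'I_n}}) (S : {set 'I_n}) : bool :=
  [forall B in A, (1 <= #|B :&: S|)%N].

(* The event |H| = k; k is an integer because the threshold it is compared with
   is the floor of a real number, which may be negative for small n. *)
Definition min_hitting_size (n : nat) (A : {set {set 'I_n}}) (k : int) : bool :=
  [exists S : {set 'I_n}, hitting_set A S && (#|S|%:Z == k)] &&
  ~~ [exists S : {set 'I_n}, hitting_set A S && (#|S|%:Z < k)].

Definition lg (R : realType) (x : R) : R := ln x / ln 2.

Definition hs_delta (R : realType) (beta : R) : R :=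
  beta `^ (- beta) * (1 - beta) `^ (- (1 - beta)).

Definition hs_gamma (R : realType) (beta : R) : R :=
  Num.max 1 ((1 - beta) / beta).

Definition hs_o (R : realType) (beta : R) (omega : nat -> R) (n : nat) : R :=
  lg (n%:R * ln (hs_delta beta) - 2^-1 * ln n%:R
      + ln (hs_gamma beta) * lg n%:R + ln (omega n))
  - lg (n%:R * ln (hs_delta beta)).

Definition hs_h (R : realType) (beta : R) (omega : nat -> R) (n : nat) : int :=
  Num.floor ((1 - beta) * n%:R - lg (n%:R * ln (hs_delta beta))
             - hs_o beta omega n) + 1.

(* Main.v *)
(**
First moment for sizes at most h - 1, second moment for size h + 1.

A set S of size s is hitting iff none of the 2^(n-s) subsets of its complement
is picked.  For k = h - 1 the expected number of hitting sets is at most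
C(n,k) exp(-p 2^(n-k)) <= C(n,k) exp(-L_n), where L_n is the argument of the
first logarithm in o_n; Stirling's formula and Gibbs' inequality bound this by
a constant over omega(n), the term (ln gamma)(lg n) in L_n paying for the shift
of k below (1-beta)n by about lg n.

Two sets S, T of size s whose complements share j elements are both hitting
with probability (1-p)^(2 * 2^(n-s) - 2^j).  For s = h + 1, p 2^(n-s) < L_n / 2.
The pairs with |T \ S| < 2 log_2 n are too few to matter, at most n^O(log n)
for each S against C(n,s) = exp((1+o(1)) n ln delta); for the others the
correlation factor (1-p)^(-2^j) is exp(O(L_n / n^2)).  Chebyshev's inequality
concludes.
*)

Require Import Defs.
From HB Require Import structures.
From mathcomp Require Import all_boot all_order all_algebra.
From mathcomp Require Import all_classical all_reals all_analysis.
From mathcomp Require Import ring lra zify.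

Set Implicit Arguments.
Unset Strict Implicit.
Unset Printing Implicit Defensive.

Import Order.TTheory GRing.Theory Num.Theory.
Import numFieldNormedType.Exports.

Local Open Scope classical_set_scope.
Local Open Scope ring_scope.

(** * First and second moments over random set systems *)

Lemma set_system_weight_ge0 (R : realType) (n : nat) (p : R)
    (A : {set {set 'I_n}}) : 0 <= p <= 1 -> 0 <= set_system_weight p A.
Proof. by move=> /andP[p0 p1]; apply: prodr_ge0 => B _; case: ifP; lra. Qed.

Lemma le_set_system_prob (R : realType) (n : nat) (p : R)
    (E F : pred {set {set 'I_n}}) : 0 <= p <= 1 -> (forall A, E A -> F A) ->
  set_system_prob p E <= set_system_prob p F.
Proof.
move=> p01 EF; rewrite /set_system_prob (big_mkcond E) (big_mkcond F) /=.
apply: ler_sum => A _; have := EF A; have := @set_system_weight_ge0 R n p A p01.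
by case: (E A) (F A) => [] [] // w0 /(_ isT).
Qed.

Lemma set_system_probC (R : realType) (n : nat) (p : R)
    (E : pred {set {set 'I_n}}) :
  set_system_prob p (fun A => ~~ E A) = 1 - set_system_prob p E.
Proof.
rewrite -(set_system_prob_total n p) /set_system_prob [in RHS](bigID E) /=.
by rewrite [RHS]addrC addKr.
Qed.

Lemma set_system_prob_le1 (R : realType) (n : nat) (p : R)
    (E : pred {set {set 'I_n}}) : 0 <= p <= 1 -> set_system_prob p E <= 1.
Proof.
by move=> p01; rewrite -(set_system_prob_total n p); exact: le_set_system_prob.
Qed.

Lemma set_system_probU (R : realType) (n : nat) (p : R)
    (E F : pred {set {set 'I_n}}) : 0 <= p <= 1 ->
  set_system_prob p (fun A => E A || F A) <=
  set_system_prob p E + set_system_prob p F.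
Proof.
move=> p01; rewrite /set_system_prob (big_mkcond E) (big_mkcond F) /=.
rewrite -big_split /= big_mkcond; apply: ler_sum => A _.
have := @set_system_weight_ge0 R n p A p01.
by case: (E A) (F A) => [] [] /=; lra.
Qed.

(** Union bound: after exchanging the sums, a system that satisfies the existential is counted at
    least once on the right. *)
Lemma set_system_prob_exists (R : realType) (n : nat) (p : R) (I : finType)
    (P : pred I) (E : I -> pred {set {set 'I_n}}) : 0 <= p <= 1 ->
  set_system_prob p (fun A => [exists i, E i A && P i]) <=
  \sum_(i | P i) set_system_prob p (E i).
Proof.
move=> p01; rewrite /set_system_prob.
under [leRHS]eq_bigr do rewrite big_mkcond.
rewrite exchange_big big_mkcond /=; apply: ler_sum => A _.
have w0 := @set_system_weight_ge0 R n p A p01.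
case: existsP => [[i /andP[EiA Pi]]|_].
  by rewrite (bigD1 i) //= EiA lerDl; apply: sumr_ge0 => j _; case: ifP.
by apply: sumr_ge0 => j _; case: ifP.
Qed.

(** Distributivity expands a product of two-term sums over all systems; the zero placed at members
    of [F] kills every system that meets [F]. *)
Lemma set_system_prob_avoid (R : realType) (n : nat) (p : R)
    (F : {set {set 'I_n}}) :
  set_system_prob p (fun A => F \subset ~: A) = (1 - p) ^+ #|F|.
Proof.
rewrite /set_system_prob /set_system_weight.
transitivity (\prod_(B : {set 'I_n}) ((if B \in F then 0 else p) + (1 - p))).
  rewrite bigA_distr big_mkcond /=; apply: eq_bigr => A _.
  case: ifPn => [/fintype.subsetP dFA | /fintype.subsetPn[B BF]].
    apply: eq_bigr => B _; case: ifPn => // BA; case: ifPn => // /dFA.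
    by rewrite inE BA.
  by rewrite inE negbK => BA; rewrite (bigD1 B) //= BA BF mul0r.
rewrite (bigID (mem F)) /= [X in _ * X]big1 => [|B /negbTE ->].
  by rewrite mulr1 -prodr_const; apply: eq_bigr => B ->; rewrite add0r.
by rewrite addrC subrK.
Qed.

(** [S] misses [B] exactly when [B] lies in the complement of [S], so hitting means avoiding a whole
    powerset, an event of known probability. *)
Lemma hitting_setE (n : nat) (A : {set {set 'I_n}}) (S : {set 'I_n}) :
  hitting_set A S = (powerset (~: S) \subset ~: A).
Proof.
apply/forall_inP/fintype.subsetP => [hit B|dis B BA].
  rewrite powersetE inE; apply: contraL => /hit.
  by rewrite lt0n cards_eq0 setI_eq0 finset.disjoints_subset.
rewrite lt0n cards_eq0 setI_eq0 finset.disjoints_subset -powersetE.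
by apply/negP => /dis; rewrite inE BA.
Qed.

Lemma card_setC_ord (n : nat) (S : {set 'I_n}) : #|~: S| = (n - #|S|)%N.
Proof. by rewrite -[LHS](addKn #|S|) cardsC card_ord. Qed.

Lemma set_system_prob_hitting (R : realType) (n : nat) (p : R)
    (S : {set 'I_n}) :
  set_system_prob p (fun A => hitting_set A S) = (1 - p) ^+ (2 ^ (n - #|S|)).
Proof.
rewrite -card_setC_ord -card_powerset -set_system_prob_avoid.
by apply: eq_bigl => A; rewrite hitting_setE.
Qed.

(** Together the two events avoid the union of two powersets. These meet in the powerset of the
    common complement, which has n - s - |T \ S| elements. *)
Lemma set_system_prob_hitting2 (R : realType) (n s : nat) (p : R)
    (S T : {set 'I_n}) : #|S| = s -> #|T| = s ->
  set_system_prob p (fun A => hitting_set A S && hitting_set A T) =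
  (1 - p) ^+ (2 * 2 ^ (n - s) - 2 ^ (n - s - #|T :\: S|)).
Proof.
move=> cS cT.
have -> : (2 * 2 ^ (n - s) - 2 ^ (n - s - #|T :\: S|))%N =
          #|powerset (~: S) :|: powerset (~: T)|.
  rewrite cardsU -powersetI !card_powerset.
  have cC (X : {set 'I_n}) : #|X| = s -> #|~: X| = (n - s)%N.
    by move=> <-; exact: card_setC_ord.
  rewrite !cC // mul2n addnn; congr (_ - 2 ^ _)%N.
  rewrite -(cC S) // -(cardsID (~: T) (~: S)).
  have -> : #|~: S :\: ~: T| = #|T :\: S|.
    by apply: eq_card => x; rewrite !inE negbK andbC.
  by rewrite addnK.
rewrite -set_system_prob_avoid; apply: eq_bigl => A.
by rewrite !hitting_setE finset.subUset.
Qed.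

(** Chebyshev's inequality at zero, multiplied out so that nothing is divided by the mean: each
    outcome with X = 0 contributes w mu^2 to the variance. *)
Lemma second_moment_bound (R : realType) (I : finType) (w X : I -> R) :
  (forall i, 0 <= w i) -> \sum_i w i = 1 ->
  (\sum_i w i * X i) ^+ 2 * \sum_(i | X i == 0) w i <=
  \sum_i w i * X i ^+ 2 - (\sum_i w i * X i) ^+ 2.
Proof.
move=> w0 w1; set mu := \sum_i _ * X i.
have -> : \sum_i w i * X i ^+ 2 - mu ^+ 2 = \sum_i w i * (X i - mu) ^+ 2.
  transitivity (\sum_i (w i * X i ^+ 2 - 2 * mu * (w i * X i) + mu ^+ 2 * w i)).
    by rewrite big_split sumrB /= -!mulr_sumr w1 -/mu; ring.
  by apply: eq_bigr => i _; ring.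
rewrite mulr_sumr big_mkcond /=; apply: ler_sum => i _.
by case: eqP => [->|_]; [rewrite sub0r sqrrN mulrC | rewrite mulr_ge0 ?sqr_ge0].
Qed.

(** The list of elements of a small set, padded with [None] to length [r], is a tuple over
    [option T]; so these tuples map onto the small sets. *)
Lemma card_small_sets (T : finType) (r : nat) :
  (#|[set W : {set T} | #|W| <= r]%SET| <= #|T|.+1 ^ r)%N.
Proof.
rewrite -(card_option T) -(card_tuple r (option T)).
pose f (t : r.-tuple (option T)) := [set x | Some x \in t]%SET.
apply: (@leq_trans #|f @: {: r.-tuple (option T)}|); last exact: leq_imset_card.
apply: subset_leq_card; apply/fintype.subsetP => W; rewrite inE => Wr.
pose s := [seq Some x | x <- enum W] ++ nseq (r - #|W|) None.
have ss : size s == r.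
  by rewrite size_cat size_map size_nseq -cardE subnKC.
apply/imsetP; exists (Tuple ss) => //; apply/setP => x.
rewrite inE memtE /= mem_cat mem_nseq andbF orbF mem_map ?mem_enum //.
Qed.

(** [T] is recovered from its symmetric difference with [S], which has 2 |T \ S| elements because
    the two sizes agree. *)
Lemma card_close_sets (n s i : nat) (S : {set 'I_n}) : #|S| = s ->
  (#|[set T : {set 'I_n} | (#|T| == s) && (#|T :\: S| < i)]%SET| <=
   n.+1 ^ (2 * i))%N.
Proof.
move=> cS; have := @card_small_sets 'I_n (2 * i); rewrite card_ord.
apply: leq_trans.
pose f (T : {set 'I_n}) := (T :\: S) :|: (S :\: T).
have fK : {in [set T : {set 'I_n} | (#|T| == s) && (#|T :\: S| < i)%N]%SET &,
           injective f}.
  move=> T1 T2 _ _ /setP eqf; apply/setP => x; have := eqf x.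
  by rewrite !inE; do 3 case: (_ \in _).
rewrite -(card_in_imset fK); apply: subset_leq_card.
apply/fintype.subsetP => W /imsetP[T]; rewrite !inE => /andP[/eqP cT lti] ->.
have eqD : #|S :\: T| = #|T :\: S|.
  apply/eqP; rewrite -(eqn_add2l #|S :&: T|) cardsID finset.setIC cardsID.
  by rewrite cS cT.
rewrite (leq_trans (leq_card_setU _ _)) // eqD addnn -mul2n leq_mul2l /=.
exact: ltnW.
Qed.

(** The variance of the number of hitting sets of size [s], divided by the squared mean. The first
    summand comes from pairs with |T \ S| < i, the second is the excess correlation of the other
    pairs. *)
Lemma second_moment_hitting (R : realType) (n s i : nat) (p : R) :
  0 <= p < 1 -> (s <= n)%N ->
  set_system_prob p
    (fun A : {set {set 'I_n}} => ~~ [exists S, hitting_set A S && (#|S| == s)])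
  <= (n.+1 ^ (2 * i))%:R / 'C(n, s)%:R * (1 - p) ^- (2 ^ (n - s))
     + ((1 - p) ^- (2 ^ (n - s - i)) - 1).
Proof.
move=> /andP[p0 p1] sn; set q := 1 - p; set m := (n - s)%N.
have p01 : 0 <= p <= 1 by rewrite p0 ltW.
have q0 : 0 < q by rewrite subr_gt0.
have q1 : q <= 1 by rewrite /q; lra.
set N : R := 'C(n, s)%:R.
have N0 : 0 < N by rewrite ltr0n bin_gt0.
pose X (A : {set {set 'I_n}}) : R :=
  \sum_(S : {set 'I_n} | #|S| == s) (hitting_set A S)%:R.
have cN (c : R) : \sum_(S : {set 'I_n} | #|S| == s) c = N * c.
  rewrite sumr_const -mulr_natl; congr (_%:R * _).
  by rewrite -[n in RHS](card_ord n) -card_draws; apply: eq_card => S; rewrite !inE.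
have EX : \sum_A set_system_weight p A * X A = N * q ^+ (2 ^ m).
  rewrite /X; under eq_bigr do rewrite mulr_sumr.
  rewrite exchange_big -cN /=; apply: eq_bigr => S /eqP cS.
  rewrite /q /m -cS -set_system_prob_hitting /set_system_prob big_mkcond.
  by rewrite [RHS]big_mkcond /=; apply: eq_bigr => A _; case: hitting_set; rewrite ?mulr1 ?mulr0.
have EX2 : \sum_A set_system_weight p A * X A ^+ 2 <=
    N * q ^+ (2 * 2 ^ m) *
    ((n.+1 ^ (2 * i))%:R * q ^- (2 ^ m) + N * q ^- (2 ^ (m - i))).
  have -> : \sum_A set_system_weight p A * X A ^+ 2 =
      \sum_(S : {set 'I_n} | #|S| == s) \sum_(T : {set 'I_n} | #|T| == s)
        set_system_prob p (fun A => hitting_set A S && hitting_set A T).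
    rewrite /X; under eq_bigr do rewrite expr2 mulr_suml mulr_sumr.
    rewrite exchange_big; apply: eq_bigr => S _ /=.
    under eq_bigr do rewrite mulr_sumr mulr_sumr.
    rewrite exchange_big; apply: eq_bigr => T _ /=.
    rewrite /set_system_prob [RHS]big_mkcond; apply: eq_bigr => A _.
    by do 2 case: hitting_set; rewrite ?(mulr1, mulr0, mul0r).
  rewrite -mulrA -cN; apply: ler_sum => S /eqP cS.
  have qE k : (k <= m)%N -> q ^+ (2 * 2 ^ m - 2 ^ k) = q ^+ (2 * 2 ^ m) * q ^- (2 ^ k).
    move=> km; rewrite -[in RHS](@subnK (2 ^ k) (2 * 2 ^ m)).
      by rewrite exprD mulfK // expf_neq0 // gt_eqF.
    by rewrite (leq_trans (leq_pexp2l _ km)) // leq_pmull.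
  have qV k l : (k <= l)%N -> q ^- k <= q ^- l.
    move=> kl; rewrite lef_pV2 ?posrE ?exprn_gt0 //.
    by apply: ler_wiXn2l; rewrite // ltW.
  rewrite (bigID (fun T : {set 'I_n} => #|T :\: S| < i)%N) /= mulrDr lerD //.
    (* A close pair is bounded by q^(2^m), the probability that one of its sets is hitting; it then
       remains to count the close pairs. *)
    apply: (@le_trans _ _ (\sum_(T : {set 'I_n} | (#|T| == s) && (#|T :\: S| < i)%N)
               q ^+ (2 * 2 ^ m) * q ^- (2 ^ m))).
      apply: ler_sum => T /andP[/eqP cT _].
      rewrite (set_system_prob_hitting2 p cS cT) qE ?leq_subr //.
      by rewrite ler_wpM2l ?exprn_ge0 ?(ltW q0) // qV // leq_pexp2l ?leq_subr.
    rewrite sumr_const mulrCA -[leLHS]mulr_natl.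
    rewrite ler_wpM2r ?mulr_ge0 ?invr_ge0 ?exprn_ge0 ?(ltW q0) // ler_nat.
    apply: leq_trans (card_close_sets i cS).
    by apply: subset_leq_card; apply/fintype.subsetP => T; rewrite !inE.
  (* For a far pair the common complement has at most m - i elements. The target sums this bound
     over all [T], so its close terms are dropped. *)
  rewrite mulrCA -cN [leRHS](bigID (fun T : {set 'I_n} => #|T :\: S| < i)%N) /=.
  apply: ler_wpDl.
    apply: sumr_ge0 => T _.
    by rewrite mulr_ge0 ?invr_ge0 ?exprn_ge0 ?(ltW q0).
  apply: ler_sum => T /andP[/eqP cT]; rewrite -leqNgt => iT.
  rewrite (set_system_prob_hitting2 p cS cT) qE ?leq_subr //.
  rewrite ler_wpM2l ?exprn_ge0 ?(ltW q0) // qV // leq_pexp2l //.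
  by rewrite leq_sub2l.
have := @second_moment_bound R _ (set_system_weight p) X
  (fun A => set_system_weight_ge0 A p01) (set_system_prob_total n p).
rewrite EX.
have -> : \sum_(A | X A == 0) set_system_weight p A = set_system_prob p
    (fun A : {set {set 'I_n}} => ~~ [exists S, hitting_set A S && (#|S| == s)]).
  apply: eq_bigl => A; rewrite /X; apply/eqP/existsPn => [X0 S|nohit].
    have /psumr_eq0P/(_ X0 S) : forall S : {set 'I_n}, #|S| == s ->
      0 <= (hitting_set A S)%:R :> R by move=> *; rewrite ler0n.
    case: (#|S| == s) => [/(_ isT)|]; rewrite ?andbF //.
    by case: hitting_set => // /eqP; rewrite oner_eq0.
  by apply: big1 => S cS; have := nohit S; rewrite cS andbT => /negbTE ->.
move/le_trans => /(_ _ (lerB EX2 (lexx _))).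
(* The squared mean is N^2 q^(2 * 2^m); dividing by it turns the variance bound into the claim. *)
have q2 : q ^+ (2 * 2 ^ m) = (q ^+ (2 ^ m)) ^+ 2 by rewrite -exprM mulnC.
rewrite q2 exprMn => le2.
have M0 : 0 < N ^+ 2 * q ^+ (2 ^ m) ^+ 2 by rewrite mulr_gt0 ?exprn_gt0.
rewrite -(ler_pM2l M0); apply: le_trans le2 _.
rewrite le_eqVlt; apply/orP; left; apply/eqP; field.
by rewrite !gt_eqF ?exprn_gt0.
Qed.

(** Union bound over the sets of size [k], with 1 - p <= exp(-p). *)
Lemma set_system_prob_hitting_size (R : realType) (n k : nat) (p : R) :
  0 <= p < 1 -> (k <= n)%N ->
  set_system_prob p
    (fun A : {set {set 'I_n}} => [exists S, hitting_set A S && (#|S| == k)])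
  <= 'C(n, k)%:R * expR (- (p * 2 ^+ (n - k))).
Proof.
move=> /andP[p0 p1] kn.
apply: le_trans (@set_system_prob_exists R n p {set 'I_n}
  (fun S => #|S| == k) (fun S A => hitting_set A S) _) _; first by rewrite p0 ltW.
apply: (@le_trans _ _ (\sum_(S : {set 'I_n} | #|S| == k)
          expR (- (p * 2 ^+ (n - k))))).
  apply: ler_sum => S /eqP cS; rewrite set_system_prob_hitting cS.
  rewrite -natrX -mulNr mulrC expRM_natl lerXn2r ?nnegrE ?expR_ge0 ?expR_ge1Dx //.
  by lra.
rewrite sumr_const -[leLHS]mulr_natl ler_wpM2r ?expR_ge0 // ler_nat.
rewrite -[n in 'C(n, k)](card_ord n) -card_draws.
by apply: subset_leq_card; apply/fintype.subsetP => S; rewrite !inE.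
Qed.

Lemma hitting_set_extend (n k : nat) (A : {set {set 'I_n}}) (S : {set 'I_n}) :
  (#|S| <= k <= n)%N -> hitting_set A S ->
  [exists T, hitting_set A T && (#|T| == k)].
Proof.
move=> /andP[/subnKC <-]; move: (k - #|S|)%N => d.
elim: d S => [|d IHd] S Sd hS.
  by apply/existsP; exists S; rewrite hS addn0 eqxx.
have /existsP[x xS] : [exists x, x \notin S].
  rewrite -negb_forall; apply/negP => /forallP allS.
  have : (#|S| < #|'I_n|)%N by rewrite card_ord; lia.
  by rewrite ltnNge subset_leq_card //; apply/fintype.subsetP => x _.
have cS : #|x |: S| = #|S|.+1 by rewrite cardsU1 xS.
have -> : (#|S| + d.+1 = #|x |: S| + d)%N by rewrite cS addnS.
apply: IHd; first by rewrite cS addSnnS.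
apply/forall_inP => B /(forall_inP hS) => /leq_trans; apply.
by rewrite subset_leq_card // finset.setIS // finset.subsetUr.
Qed.

(** A hitting set of size at most [k] would extend to one of size [k], so the minimum exceeds [k];
    it is at most [k.+2]. Here [k] stands for h - 1. *)
Lemma min_hitting_size_near (n k : nat) (A : {set {set 'I_n}}) : (k <= n)%N ->
  ~~ [exists S, hitting_set A S && (#|S| == k)] ->
  [exists S, hitting_set A S && (#|S| == k.+2)] ->
  min_hitting_size A (k%:Z + 1) || min_hitting_size A (k%:Z + 1 + 1).
Proof.
move=> kn nohit hit2.
have large S : hitting_set A S -> (k < #|S|)%N.
  move=> hS; rewrite ltnNge; apply: contra nohit => Sk.
  by apply: hitting_set_extend hS; rewrite Sk.
have -> : k%:Z + 1 + 1 = k.+2%:Z by lia.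
have -> : k%:Z + 1 = k.+1%:Z by lia.
rewrite /min_hitting_size; case: (boolP [exists S : {set 'I_n}, _ && (#|S|%:Z == k.+1)]) => [_|no1].
  apply/orP; left; apply/existsPn => S; rewrite negb_and -implybE.
  by apply/implyP => /large; lia.
apply/orP; right; apply/andP; split.
  by apply/existsP; case/existsP: hit2 => S hS; exists S.
apply/existsPn => S; rewrite negb_and -implybE; apply/implyP => hS.
have /existsPn/(_ S) := no1; rewrite hS /=; have := large S hS.
by move: #|S| => s; lia.
Qed.

Lemma set_system_prob_min_hitting_size (R : realType) (n k : nat) (p : R) :
  0 <= p <= 1 -> (k <= n)%N ->
  1 - set_system_prob p
        (fun A : {set {set 'I_n}} => [exists S, hitting_set A S && (#|S| == k)])
    - set_system_prob p
        (fun A : {set {set 'I_n}} => ~~ [exists S, hitting_set A S && (#|S| == k.+2)])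
  <= set_system_prob p (fun A : {set {set 'I_n}} =>
       min_hitting_size A (k%:Z + 1) || min_hitting_size A (k%:Z + 1 + 1)).
Proof.
move=> p01 kn; set E := fun A => [exists S, _ && (_ == k)].
set F := fun A => ~~ _; set G := fun A => _ || _.
have : set_system_prob p (fun A => ~~ G A) <=
       set_system_prob p (fun A => E A || F A).
  apply: le_set_system_prob => // A; apply: contraR; rewrite negb_or => /andP[nE].
  by rewrite /F negbK; exact: min_hitting_size_near.
have := set_system_probU E F p01.
by rewrite set_system_probC; lra.
Qed.

(** * Stirling's formula and binomial coefficients *)

(** Reduces the two logarithm bounds below to the sign of a derivative. *)
Lemma derivable_nonneg_ge0 (R : realType) (f df : R -> R) :
  (forall x : R, 0 <= x -> is_derive x 1 f (df x)) -> (forall x : R, 0 <= x -> 0 <= df x) ->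
  f 0 = 0 -> forall x : R, 0 <= x -> 0 <= f x.
Proof.
move=> fdf df0 f0 x x0; rewrite -f0.
apply: (@ger0_derive1_ndecry R f 0) => // [y|y|].
- by rewrite in_itv /= andbT => /ltW /fdf [].
- rewrite in_itv /= andbT => /ltW y0; rewrite derive1E.
  by have [_ ->] := fdf y y0; exact: df0.
- apply: derivable_within_continuous => y; rewrite in_itv /= andbT.
  by move=> /fdf [].
Qed.

Lemma is_derive_constD (R : realType) (a x : R) :
  is_derive x 1 (fun y : R => a + y) 1.
Proof.
rewrite -[X in is_derive _ _ _ X]add0r.
exact: (@is_deriveD _ _ _ (cst a) id).
Qed.

Lemma is_derive_ln1D (R : realType) (x : R) : 0 <= x ->
  is_derive x 1 (fun y : R => ln (1 + y)) (1 + x)^-1.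
Proof.
move=> x0; have x1 : 0 < 1 + x by lra.
have := @is_derive1_comp R (@ln R) (fun y => 1 + y) x (1 + x)^-1 1.
rewrite mulr1; apply; first exact: is_derive1_ln.
exact: is_derive_constD.
Qed.

Lemma is_derive_constD_inv (R : realType) (a x : R) : a + x != 0 ->
  is_derive x 1 (fun y : R => (a + y)^-1) (- (a + x) ^- 2).
Proof.
move=> ax; have := @is_deriveV R (fun y => a + y) x 1 1 ax (is_derive_constD a x).
by rewrite [_ *: _]mulr1.
Qed.

(** The difference has derivative x^2 / ((1 + x)(2 + x)^2). At x = 1/n the bound gives (n + 1/2)
    ln(1 + 1/n) >= 1, as Stirling's recursion requires. *)
Lemma ln1D_ge (R : realType) (x : R) : 0 <= x -> 2 * x / (2 + x) <= ln (1 + x).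
Proof.
move=> x0; have -> : 2 * x / (2 + x) = 2 - 4 * (2 + x)^-1 by field; lra.
rewrite -subr_ge0 opprB addrA.
have := @derivable_nonneg_ge0 R
  (fun x => (ln (1 + x) + 4 * (2 + x)^-1) - 2)
  (fun x => ((1 + x)^-1 + 4 * - (2 + x) ^- 2) - 0); apply; last exact: x0.
- move=> {x0}x x0; apply: is_deriveB; apply: is_deriveD; first exact: is_derive_ln1D.
  by apply: is_deriveZ; apply: is_derive_constD_inv; lra.
- move=> {x0}x x0.
  have -> : (1 + x)^-1 + 4 * - (2 + x) ^- 2 - 0 = x ^+ 2 / ((1 + x) * (2 + x) ^+ 2).
    by field; rewrite !gt_eqF; lra.
  by rewrite divr_ge0 ?mulr_ge0 ?sqr_ge0; lra.
- by rewrite !addr0 ln1; field.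
Qed.

(** The difference has derivative (1 - 1/(1 + x))^2 / 2. At x = 1/n the excess of (n + 1/2) ln(1 +
    1/n) over 1 is bounded by a telescoping difference. *)
Lemma ln1D_le (R : realType) (x : R) : 0 <= x ->
  ln (1 + x) <= x * (2 + x) / (2 * (1 + x)).
Proof.
move=> x0.
have -> : x * (2 + x) / (2 * (1 + x)) = 2^-1 * (1 + x) - 2^-1 * (1 + x)^-1.
  by field; lra.
rewrite -subr_ge0.
have := @derivable_nonneg_ge0 R
  (fun x => (2^-1 * (1 + x) - 2^-1 * (1 + x)^-1) - ln (1 + x))
  (fun x => (2^-1 * 1 - 2^-1 * - (1 + x) ^- 2) - (1 + x)^-1).
apply; last exact: x0.
- move=> {x0}x x0; apply: is_deriveB; last exact: is_derive_ln1D.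
  apply: is_deriveB; apply: is_deriveZ; first exact: is_derive_constD.
  by apply: is_derive_constD_inv; lra.
- move=> {x0}x x0.
  have -> : 2^-1 * 1 - 2^-1 * - (1 + x) ^- 2 - (1 + x)^-1 =
            2^-1 * (1 - (1 + x)^-1) ^+ 2 by field; lra.
  by rewrite mulr_ge0 ?sqr_ge0.
- by rewrite !addr0 ln1; field.
Qed.

(** Stirling's main terms for ln n!, without the constant ln sqrt(2 pi), which lies between 0 and
    1. *)
Definition stirling_approx (R : realType) (n : nat) : R :=
  (n%:R + 2^-1) * ln n%:R - n%:R.

Lemma stirling_approx_step (R : realType) (n : nat) : (0 < n)%N ->
  0 <= stirling_approx R n.+1 - stirling_approx R n - ln n.+1%:R <=
  (4 * n%:R)^-1 - (4 * n.+1%:R)^-1.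
Proof.
move=> n0; rewrite /stirling_approx -natr1; set x : R := n%:R.
have x0 : 0 < x by rewrite ltr0n.
have -> : ln (x + 1) = ln x + ln (1 + x^-1).
  by rewrite -lnM ?posrE ?addr_gt0 ?invr_gt0 // mulrDr mulr1 divff ?gt_eqF.
have v0 : 0 <= x^-1 by rewrite invr_ge0 ltW.
have := ln1D_ge v0; have := ln1D_le v0; set l := ln (1 + _) => ul ll.
have -> : (x + 1 + 2^-1) * (ln x + l) - (x + 1) - ((x + 2^-1) * ln x - x) -
          (ln x + l) = (x + 2^-1) * l - 1 by ring.
have x2 : 0 < x + 2^-1 by lra.
move: ul ll; rewrite -(ler_pM2l x2) -[_ <= l](ler_pM2l x2).
have -> : (x + 2^-1) * (x^-1 * (2 + x^-1) / (2 * (1 + x^-1))) =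
   1 + ((4 * x)^-1 - (4 * (x + 1))^-1).
  by field; rewrite !gt_eqF; lra.
have -> : (x + 2^-1) * (2 * x^-1 / (2 + x^-1)) = 1.
  by field; rewrite !gt_eqF; lra.
by move=> ? ?; apply/andP; split; lra.
Qed.

Lemma ln_fact_bounds (R : realType) (n : nat) : (0 < n)%N ->
  stirling_approx R n <= ln n`!%:R <= stirling_approx R n + 1.
Proof.
(* The lower bound is strengthened for the induction: one step loses at most 1/(4n) - 1/(4(n+1)),
   exactly the decrease of the added term. *)
move=> n0; have : stirling_approx R n + 4^-1 + (4 * n%:R)^-1 <= ln n`!%:R
   <= stirling_approx R n + 1.
  elim: n n0 => // -[_ _|n /(_ isT) /andP[IH1 IH2] _].
    by rewrite /stirling_approx (_ : 1`! = 1%N) // ln1 mulr0; apply/andP; split; lra.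
  have /andP[s1 s2] := stirling_approx_step R (ltn0Sn n).
  rewrite factS natrM lnM ?posrE ?ltr0n ?fact_gt0 //.
  move: (ln _) (ln _) (stirling_approx _ _) (stirling_approx _ _) IH1 IH2 s1 s2.
  move: ((4 * n.+1%:R)^-1) ((4 * n.+2%:R)^-1) => *.
  by apply/andP; split; lra.
have : 0 < (4 * n%:R)^-1 :> R by rewrite invr_gt0 mulr_gt0 ?ltr0n.
by move=> ? /andP[? ?]; apply/andP; split; lra.
Qed.

(** This is n times the binary entropy of k/n, in natural units. *)
Definition ln_entropy (R : realType) (n k : nat) : R :=
  n%:R * ln n%:R - k%:R * ln k%:R - (n - k)%:R * ln (n - k)%:R.

(** Each factorial is known up to an error in [0, 1]: the two in the denominator cost 2 below, the
    one in the numerator costs 1 above. *)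
Lemma ln_bin_bounds (R : realType) (n k : nat) : (0 < k < n)%N ->
  ln_entropy R n k + 2^-1 * (ln n%:R - ln k%:R - ln (n - k)%:R) - 2
  <= ln 'C(n, k)%:R <=
  ln_entropy R n k + 2^-1 * (ln n%:R - ln k%:R - ln (n - k)%:R) + 1.
Proof.
move=> /andP[k0 kn].
have nk0 : (0 < n - k)%N by rewrite subn_gt0.
have := congr1 (fun m => ln m%:R : R) (bin_fact (ltnW kn)).
rewrite !natrM !lnM ?posrE ?mulr_gt0 ?ltr0n ?bin_gt0 ?fact_gt0 ?(ltnW kn) //.
have /andP[] := ln_fact_bounds R k0; have /andP[] := ln_fact_bounds R nk0.
have /andP[] := ln_fact_bounds R (leq_ltn_trans (leq0n k) kn).
have : (n - k)%:R = n%:R - k%:R :> R by rewrite natrB // ltnW.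
rewrite /stirling_approx /ln_entropy => nkE ? ? ? ? ? ? ?.
by apply/andP; split; lra.
Qed.

(** Gibbs' inequality: entropy is at most the cross entropy with a coin of bias [x]. *)
Lemma ln_entropy_le (R : realType) (n k : nat) (x : R) : (0 < k < n)%N ->
  0 < x < 1 ->
  ln_entropy R n k <= - (k%:R * ln x) - (n - k)%:R * ln (1 - x).
Proof.
move=> /andP[k0 kn] /andP[x0 x1].
(* This is ln(1 + t) <= t at t = b/a - 1. For the pairs (k, xn) and (n - k, (1 - x)n) the right
   sides add up to 0. *)
have key (a b : R) : 0 < a -> 0 < b -> a * (ln b - ln a) <= b - a.
  move=> a0 b0; rewrite -ln_div ?posrE //.
  have := @le_ln1Dx R (b / a - 1); rewrite addrCA subrr addr0.
  have ba : 0 < b / a by rewrite divr_gt0.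
  move=> /(_ ltac:(lra)); rewrite -(ler_pM2l a0).
  by rewrite mulrBr mulr1 mulrCA divff ?gt_eqF // mulr1.
have n0 : 0 < n%:R :> R by rewrite ltr0n (leq_ltn_trans _ kn).
have nk0 : 0 < (n - k)%:R :> R by rewrite ltr0n subn_gt0.
have k0' : 0 < k%:R :> R by rewrite ltr0n.
have := key _ _ k0' (mulr_gt0 x0 n0).
have y0 : 0 < 1 - x by lra.
have := key _ _ nk0 (mulr_gt0 y0 n0).
rewrite !lnM ?posrE // /ln_entropy.
have -> : (n - k)%:R = n%:R - k%:R :> R by rewrite natrB // ltnW.
by move: (ln _) (ln _) (ln _) (ln _) (ln _) => *; nra.
Qed.

(** * Asymptotics *)

Lemma near_cvg_eq (R : realType) (u v : nat -> R) (l : R) :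
  (\forall n \near \oo, u n = v n) -> u n @[n --> \oo] --> l ->
  v n @[n --> \oo] --> l.
Proof. by move=> uv; apply: cvg_trans; apply: near_eq_cvg; exact: uv. Qed.

Lemma near_nat_ge (m : nat) : \forall n \near \oo, (m <= n)%N.
Proof. by exists m. Qed.

Lemma cvg_invn (R : realType) : (n%:R^-1 : R) @[n --> \oo] --> (0 : R).
Proof.
apply/(@gtr0_cvgV0 _ _ _ _ (fun n : nat => n%:R : R)); last exact: cvgr_idn.
by exists 1%N => // n /= n0; rewrite ltr0n.
Qed.

Lemma cvg_ln_natr (R : realType) : (ln n%:R : R) @[n --> \oo] --> +oo.
Proof.
apply/cvgryPge => A; have /cvgryPge/(_ (expR A)) := @cvgr_idn R.
apply: filterS => n An; rewrite -(expRK A) ler_ln ?posrE ?expR_gt0 //.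
exact: lt_le_trans (expR_gt0 _) An.
Qed.

Lemma cvg_sqr_ln_div (R : realType) :
  (ln n%:R ^+ 2 / n%:R : R) @[n --> \oo] --> (0 : R).
Proof.
have /cvgryPge ln_ge := @cvg_ln_natr R.
apply: (@squeeze_cvgr _ _ _ _ (cst 0) (fun n => 6 * (ln n%:R)^-1)).
- near=> n.
  have y1 : 1 <= ln n%:R :> R by near: n; exact: ln_ge.
  have n0 : 0 < n%:R :> R by rewrite ltr0n; near: n; exact: near_nat_ge.
  apply/andP; split; first by rewrite divr_ge0 ?sqr_ge0 // ltW.
  have y0 : 0 < ln n%:R :> R by lra.
  rewrite ler_pdivrMr // mulrAC ler_pdivlMr // -exprSr.
  (* With y = ln n, exp y >= 1 + y^3 / 6 yields y^2 / n <= 6 / y. *)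
  have := @expR_ge1Dxn R (ln n%:R) 2 (ltW y0); rewrite lnK ?posrE //.
  by rewrite (_ : 3`!%:R = 6 :> R) //; lra.
- exact: cvg_cst.
- rewrite -[X in _ --> X](mulr0 6); apply: cvgMl_tmp.
  apply/gtr0_cvgV0; last exact: cvg_ln_natr.
  by near=> n; apply: (@lt_le_trans _ _ 1) => //; near: n; exact: ln_ge.
Unshelve. all: by end_near. Qed.

Lemma cvg_ln_div (R : realType) : (ln n%:R / n%:R : R) @[n --> \oo] --> (0 : R).
Proof.
have /cvgryPge ln_ge := @cvg_ln_natr R.
apply: (@squeeze_cvgr _ _ _ _ (cst 0) (fun n => ln n%:R ^+ 2 / n%:R)).
- near=> n.
  have y1 : 1 <= ln n%:R :> R by near: n; exact: ln_ge.
  apply/andP; split; first by rewrite divr_ge0 ?ler0n //; lra.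
  by rewrite ler_wpM2r ?invr_ge0 ?ler0n //; nra.
- exact: cvg_cst.
- exact: cvg_sqr_ln_div.
Unshelve. all: by end_near. Qed.

(** * The constant ln delta, the quantity L_n and the threshold *)

Lemma ln_hs_delta (R : realType) (beta : R) : 0 < beta < 1 ->
  ln (hs_delta beta) = - (beta * ln beta) - (1 - beta) * ln (1 - beta).
Proof.
move=> /andP[b0 b1]; have c0 : 0 < 1 - beta by lra.
by rewrite /hs_delta lnM ?posrE ?powR_gt0 // !ln_powR !mulNr.
Qed.

Lemma ln_hs_delta_gt0 (R : realType) (beta : R) : 0 < beta < 1 ->
  0 < ln (hs_delta beta).
Proof.
move=> b01; have /andP[b0 b1] := b01; rewrite ln_hs_delta //.
have lb : ln beta < 0 by apply: ln_lt0; rewrite b0.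
have lc : ln (1 - beta) < 0 by apply: ln_lt0; lra.
by nra.
Qed.

Lemma ln2_gt0 (R : realType) : 0 < ln 2 :> R.
Proof. by apply: ln_gt0; lra. Qed.

Lemma powR2_lg (R : realType) (x : R) : 0 < x -> 2 `^ lg x = x.
Proof.
move=> x0; rewrite /powR /lg pnatr_eq0 /= divfK ?gt_eqF ?ln2_gt0 //.
by rewrite lnK.
Qed.

(* The argument of the first logarithm in [hs_o]. *)
Definition hs_L (R : realType) (beta : R) (omega : nat -> R) (n : nat) : R :=
  n%:R * ln (hs_delta beta) - 2^-1 * ln n%:R
  + ln (hs_gamma beta) * lg n%:R + ln (omega n).

(** Only n ln delta survives the division by n: the other terms are multiples of ln n, or ln
    omega(n) = o(n). *)
Lemma cvg_hs_L_div (R : realType) (beta : R) (omega : nat -> R) :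
  ((fun n : nat => ln (omega n)) =o_\oo (fun n : nat => n%:R : R)) ->
  hs_L beta omega n / n%:R @[n --> \oo] --> ln (hs_delta beta).
Proof.
move=> lno.
have lnw : ln (omega n) / n%:R @[n --> \oo] --> (0 : R).
  apply/cvgr0Pnorm_le => e e0; near=> n.
  have n0 : 0 < n%:R :> R by rewrite ltr0n; near: n; exact: near_nat_ge.
  rewrite normrM normfV ler_pdivrMr ?normr_gt0 ?gt_eqF //.
  by near: n; exact: (proj1 (eqoP _ _ _) lno).
apply: (@near_cvg_eq _ (fun n => ln (hs_delta beta) - 2^-1 * (ln n%:R / n%:R)
  + ln (hs_gamma beta) / ln 2 * (ln n%:R / n%:R) + ln (omega n) / n%:R)).
  near=> n.
  have n0 : 0 < n%:R :> R by rewrite ltr0n; near: n; exact: near_nat_ge.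
  have l2 := @ln2_gt0 R.
  by rewrite /hs_L /lg; field; rewrite !gt_eqF.
rewrite -[X in _ --> X]addr0; apply: cvgD => //.
rewrite -[X in _ --> X]addr0 -[X in _ + X](mulr0 (ln (hs_gamma beta) / ln 2)).
apply: cvgD; last by apply: cvgMl_tmp; exact: cvg_ln_div.
rewrite -[X in _ --> X]subr0 -[X in _ - X](mulr0 2^-1).
by apply: cvgB; [exact: cvg_cst | apply: cvgMl_tmp; exact: cvg_ln_div].
Unshelve. all: by end_near. Qed.

Lemma near_hs_L_gt0 (R : realType) (beta : R) (omega : nat -> R) :
  0 < beta < 1 ->
  ((fun n : nat => ln (omega n)) =o_\oo (fun n : nat => n%:R : R)) ->
  \forall n \near \oo, 0 < hs_L beta omega n.
Proof.
move=> b01 /(@cvg_hs_L_div _ beta) cL; near=> n.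
have n0 : 0 < n%:R :> R by rewrite ltr0n; near: n; exact: near_nat_ge.
rewrite -(pmulr_lgt0 (x := n%:R^-1)) ?invr_gt0 //.
by near: n; apply: (cvgr_gt _ cL); exact: ln_hs_delta_gt0.
Unshelve. all: by end_near. Qed.

(** A difference of logarithms is the logarithm of the ratio L_n / (n ln delta), which tends to
    1. *)
Lemma cvg_hs_o (R : realType) (beta : R) (omega : nat -> R) :
  0 < beta < 1 ->
  ((fun n : nat => ln (omega n)) =o_\oo (fun n : nat => n%:R : R)) ->
  hs_o beta omega n @[n --> \oo] --> (0 : R).
Proof.
move=> b01 lno; have D0 := ln_hs_delta_gt0 b01; have L0 := near_hs_L_gt0 b01 lno.
apply: (@near_cvg_eq _ (fun n => (ln 2)^-1 *
  ln (hs_L beta omega n / n%:R / ln (hs_delta beta)))).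
  near=> n; have Ln : 0 < hs_L beta omega n by near: n.
  have n0 : 0 < n%:R :> R by rewrite ltr0n; near: n; exact: near_nat_ge.
  rewrite /hs_o -/(hs_L beta omega n) /lg -mulrBl mulrC; congr (_ * _).
  by rewrite -ln_div ?posrE ?mulr_gt0 // invfM mulrA.
rewrite -[X in _ --> X](mulr0 (ln 2)^-1); apply: cvgMl_tmp; rewrite -[X in _ --> X]ln1.
apply: (continuous_cvg _ (continuous_ln _)); first exact: ltr01.
rewrite -[X in _ --> X](divff (lt0r_neq0 D0)); apply: cvgMr_tmp.
exact: cvg_hs_L_div.
Unshelve. all: by end_near. Qed.

(** The quantity whose floor enters [hs_h]: lg(n ln delta) + o_n collapses to lg L_n. *)
Definition hs_threshold (R : realType) (beta : R) (omega : nat -> R) (n : nat) : R :=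
  (1 - beta) * n%:R - lg (hs_L beta omega n).

(* [hs_h - 1] as soon as the threshold is nonnegative. *)
Definition hs_k (R : realType) (beta : R) (omega : nat -> R) (n : nat) : nat :=
  `|Num.floor (hs_threshold beta omega n)|%N.

Lemma cvg_hs_threshold_div (R : realType) (beta : R) (omega : nat -> R) :
  0 < beta < 1 ->
  ((fun n : nat => ln (omega n)) =o_\oo (fun n : nat => n%:R : R)) ->
  hs_threshold beta omega n / n%:R @[n --> \oo] --> (1 - beta : R).
Proof.
move=> b01 lno; have D0 := ln_hs_delta_gt0 b01; have L0 := near_hs_L_gt0 b01 lno.
apply: (@near_cvg_eq _ (fun n => (1 - beta) - (ln 2)^-1 *
  (ln (hs_L beta omega n / n%:R) * n%:R^-1 + ln n%:R / n%:R))).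
  near=> n; have Ln : 0 < hs_L beta omega n by near: n.
  have n0 : 0 < n%:R :> R by rewrite ltr0n; near: n; exact: near_nat_ge.
  rewrite ln_div ?posrE // /hs_threshold /lg.
  by have l2 := @ln2_gt0 R; field; rewrite !gt_eqF.
rewrite -[X in _ --> X]subr0; apply: cvgB; first exact: cvg_cst.
rewrite -[X in _ --> X](mulr0 (ln 2)^-1); apply: cvgMl_tmp.
rewrite -[X in _ --> X]addr0; apply: cvgD; last exact: cvg_ln_div.
rewrite -[X in _ --> X](mulr0 (ln (ln (hs_delta beta)))).
apply: cvgM; last exact: cvg_invn.
by apply: (continuous_cvg _ (continuous_ln D0)); exact: cvg_hs_L_div.
Unshelve. all: by end_near. Qed.

(** The threshold divided by n tends to 1 - beta > 0, so the floor is eventually nonnegative and the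
    absolute value in [hs_k] changes nothing. *)
Lemma near_hs_k_floor (R : realType) (beta : R) (omega : nat -> R) :
  0 < beta < 1 ->
  ((fun n : nat => ln (omega n)) =o_\oo (fun n : nat => n%:R : R)) ->
  \forall n \near \oo, (hs_k beta omega n)%:Z = Num.floor (hs_threshold beta omega n)
    /\ hs_threshold beta omega n - 1 < (hs_k beta omega n)%:R <= hs_threshold beta omega n.
Proof.
move=> b01 lno; have cT := cvg_hs_threshold_div b01 lno; near=> n.
have T0 : 0 < hs_threshold beta omega n.
  have n0 : 0 < n%:R :> R by rewrite ltr0n; near: n; exact: near_nat_ge.
  rewrite -(pmulr_lgt0 (x := n%:R^-1)) ?invr_gt0 //.
  by near: n; apply: (cvgr_gt _ cT); case/andP: b01 => _; lra.
have f0 : (0 <= Num.floor (hs_threshold beta omega n))%R by rewrite floor_ge_int ltW.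
have kE : (hs_k beta omega n)%:Z = Num.floor (hs_threshold beta omega n).
  by rewrite /hs_k gez0_abs.
split=> //; rewrite -[(hs_k _ _ _)%:R]/((hs_k beta omega n)%:Z%:~R) kE.
by have := floor_itv (hs_threshold beta omega n); rewrite intrD => /andP[? ?]; lra.
Unshelve. all: by end_near. Qed.

Lemma cvg_hs_k_div (R : realType) (beta : R) (omega : nat -> R) :
  0 < beta < 1 ->
  ((fun n : nat => ln (omega n)) =o_\oo (fun n : nat => n%:R : R)) ->
  (hs_k beta omega n)%:R / n%:R @[n --> \oo] --> (1 - beta : R).
Proof.
move=> b01 lno; have cT := cvg_hs_threshold_div b01 lno.
apply: (@squeeze_cvgr _ _ _ _ (fun n => hs_threshold beta omega n / n%:R - n%:R^-1)
  (fun n => hs_threshold beta omega n / n%:R)) => //.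
- near=> n.
  have n0 : 0 < n%:R^-1 :> R.
    by rewrite invr_gt0 ltr0n; near: n; exact: near_nat_ge.
  have [_ /andP[kT1 kT2]] : (hs_k beta omega n)%:Z = Num.floor (hs_threshold beta omega n)
    /\ hs_threshold beta omega n - 1 < (hs_k beta omega n)%:R <= hs_threshold beta omega n.
    by near: n; exact: near_hs_k_floor.
  by apply/andP; split; nra.
- rewrite -[X in _ --> X]subr0; apply: cvgB => //; exact: cvg_invn.
Unshelve. all: by end_near. Qed.

(** * Binomial coefficients whose lower index is proportional to n *)

Lemma near_proportional (R : realType) (s : nat -> nat) (x : R) : 0 < x < 1 ->
  (s n)%:R / n%:R @[n --> \oo] --> x -> \forall n \near \oo, (0 < s n < n)%N.
Proof.
move=> /andP[x0 x1] cs; near=> n.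
have n0 : 0 < n%:R :> R by rewrite ltr0n; near: n; exact: near_nat_ge.
have sn0 : 0 < (s n)%:R / n%:R :> R by near: n; exact: cvgr_gt cs _ x0.
have sn1 : (s n)%:R / n%:R < 1 :> R by near: n; exact: cvgr_lt cs _ x1.
move: sn0 sn1; rewrite pmulr_lgt0 ?invr_gt0 // ltr_pdivrMr // mul1r ltr0n ltr_nat.
by move=> -> ->.
Unshelve. all: by end_near. Qed.

(** The ratio n^2 / (s(n - s)) tends to 1 / (x(1 - x)). Hence Stirling's correction is -(1/2) ln n +
    O(1), which explains that term of L_n. *)
Lemma cvg_ln_ratio (R : realType) (s : nat -> nat) (x : R) : 0 < x < 1 ->
  (s n)%:R / n%:R @[n --> \oo] --> x ->
  ln n%:R + (ln n%:R - ln (s n)%:R - ln (n - s n)%:R) @[n --> \oo]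
    --> - ln x - ln (1 - x).
Proof.
move=> x01 cs; have sn := near_proportional x01 cs; case/andP: x01 => x0 x1.
apply: (@near_cvg_eq _ (fun n => - ln ((s n)%:R / n%:R)
                                 - ln (1 - (s n)%:R / n%:R))).
  near=> n; have /andP[s0 s1] : (0 < s n < n)%N by near: n.
  have n0 : (0 < n)%N by rewrite (leq_ltn_trans _ s1).
  have -> : 1 - (s n)%:R / n%:R = (n - s n)%:R / n%:R :> R.
    by rewrite natrB ?(ltnW s1) // mulrBl divff // pnatr_eq0 -lt0n.
  by rewrite !ln_div ?posrE ?ltr0n ?subn_gt0 //; ring.
apply: cvgB.
  by apply: cvgN; apply: (continuous_cvg _ (continuous_ln x0)).
have y0 : 0 < 1 - x by lra.
apply: (continuous_cvg _ (continuous_ln y0)); apply: cvgB => //.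
exact: cvg_cst.
Unshelve. all: by end_near. Qed.

(** Since s + (n - s) = n, the ln n terms cancel and leave the entropy function, continuous at [x],
    evaluated at s/n. *)
Lemma cvg_ln_entropy_div (R : realType) (s : nat -> nat) (x : R) : 0 < x < 1 ->
  (s n)%:R / n%:R @[n --> \oo] --> x ->
  ln_entropy R n (s n) / n%:R @[n --> \oo] -->
    - (x * ln x) - (1 - x) * ln (1 - x).
Proof.
move=> x01 cs; have sn := near_proportional x01 cs; case/andP: x01 => x0 x1.
apply: (@near_cvg_eq _ (fun n =>
  - ((s n)%:R / n%:R * ln ((s n)%:R / n%:R))
  - (1 - (s n)%:R / n%:R) * ln (1 - (s n)%:R / n%:R))).
  near=> n; have /andP[s0 s1] : (0 < s n < n)%N by near: n.
  have n0 : (0 < n)%N by rewrite (leq_ltn_trans _ s1).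
  have nn0 : n%:R != 0 :> R by rewrite pnatr_eq0 -lt0n.
  have -> : 1 - (s n)%:R / n%:R = (n - s n)%:R / n%:R :> R.
    by rewrite natrB ?(ltnW s1) // mulrBl divff.
  rewrite !ln_div ?posrE ?ltr0n ?subn_gt0 // /ln_entropy natrB ?(ltnW s1) //.
  by field.
have y0 : 0 < 1 - x by lra.
have cy : 1 - (s n)%:R / n%:R @[n --> \oo] --> 1 - x.
  by apply: cvgB => //; exact: cvg_cst.
apply: cvgB; first apply: cvgN; apply: cvgM => //.
  by apply: (continuous_cvg _ (continuous_ln x0)).
by apply: (continuous_cvg _ (continuous_ln y0)).
Unshelve. all: by end_near. Qed.

Lemma cvg_ln_bin_div (R : realType) (s : nat -> nat) (x : R) : 0 < x < 1 ->
  (s n)%:R / n%:R @[n --> \oo] --> x ->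
  ln 'C(n, s n)%:R / n%:R @[n --> \oo] -->
    - (x * ln x) - (1 - x) * ln (1 - x).
Proof.
move=> x01 cs; have sn := near_proportional x01 cs.
have cE := cvg_ln_entropy_div x01 cs.
pose e n : R := ln n%:R - ln (s n)%:R - ln (n - s n)%:R.
have ce (c : R) : (2^-1 * e n + c) / n%:R @[n --> \oo] --> (0 : R).
  apply: (@near_cvg_eq _ (fun n => (2^-1 * (ln n%:R + e n) + c) * n%:R^-1
                                   - 2^-1 * (ln n%:R / n%:R))).
    by near=> n; ring.
  rewrite -[X in _ --> X]subr0 -[X in _ - X](mulr0 2^-1); apply: cvgB; last first.
    by apply: cvgMl_tmp; exact: cvg_ln_div.
  rewrite -[X in _ --> X](mulr0 (2^-1 * (- ln x - ln (1 - x)) + c)).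
  apply: cvgM; last exact: cvg_invn.
  apply: cvgD; last exact: cvg_cst.
  by apply: cvgMl_tmp; exact: cvg_ln_ratio.
apply: (@squeeze_cvgr _ _ _ _
  (fun n => ln_entropy R n (s n) / n%:R + (2^-1 * e n + (- 2)) / n%:R)
  (fun n => ln_entropy R n (s n) / n%:R + (2^-1 * e n + 1) / n%:R)).
- near=> n; have sn' : (0 < s n < n)%N by near: n.
  have /andP[l1 l2] := ln_bin_bounds R sn'.
  by rewrite -!mulrDl !ler_wpM2r ?invr_ge0 ?ler0n // !addrA.
- by rewrite -[X in _ --> X]addr0; exact: cvgD.
- by rewrite -[X in _ --> X]addr0; exact: cvgD.
Unshelve. all: by end_near. Qed.

(** * First moment at size h - 1 *)

Lemma mul_powR2_exp (R : realType) (beta : R) (n s : nat) : (s <= n)%N ->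
  2 `^ (- (n%:R * beta)) * 2 ^+ (n - s) = 2 `^ ((1 - beta) * n%:R - s%:R).
Proof.
move=> sn; rewrite -powR_mulrn // -powRD ?pnatr_eq0 ?implybT // natrB //.
by congr (_ `^ _); ring.
Qed.

Lemma near_hs_L_ge (R : realType) (beta : R) (omega : nat -> R) (a : R) :
  0 < beta < 1 ->
  ((fun n : nat => ln (omega n)) =o_\oo (fun n : nat => n%:R : R)) ->
  \forall n \near \oo, a <= hs_L beta omega n.
Proof.
move=> b01 /(@cvg_hs_L_div _ beta) cL; have D0 := ln_hs_delta_gt0 b01.
have /cvgryPge/(_ (2 / ln (hs_delta beta) * `|a|)) n_ge := @cvgr_idn R.
near=> n.
have n0 : 0 < n%:R :> R by rewrite ltr0n; near: n; exact: near_nat_ge.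
have Ln : ln (hs_delta beta) / 2 < hs_L beta omega n / n%:R.
  by near: n; apply: (cvgr_gt _ cL); lra.
have an : 2 / ln (hs_delta beta) * `|a| <= n%:R by near: n; exact: n_ge.
apply: le_trans (ler_norm a) _; move: Ln; rewrite ltr_pdivlMr // => /ltW.
apply: le_trans; rewrite mulrC -ler_pdivrMr; last by lra.
by apply: le_trans an; rewrite invf_div mulrC.
Unshelve. all: by end_near. Qed.

Lemma cvg_first_moment (R : realType) (beta : R) (omega : nat -> R) :
  0 < beta < 1 -> omega n @[n --> \oo] --> +oo ->
  ((fun n : nat => ln (omega n)) =o_\oo (fun n : nat => n%:R : R)) ->
  'C(n, hs_k beta omega n)%:R *
    expR (- (2 `^ (- (n%:R * beta)) * 2 ^+ (n - hs_k beta omega n)))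
  @[n --> \oo] --> (0 : R).
Proof.
move=> b01 womega lno; have D0 := ln_hs_delta_gt0 b01.
have cL := @cvg_hs_L_div _ beta omega lno; have ck := cvg_hs_k_div b01 lno.
have /andP[b0 b1] := b01; have b01' : 0 < 1 - beta < 1 by lra.
have kn := near_proportional b01' ck.
have /cvgr_lt ratio_lt := cvg_ln_ratio b01' ck.
have l20 := @ln2_gt0 R.
have c0 : 0 < 1 - beta by lra.
(* [C1] and [C2] are limits plus 1, hence eventual upper bounds for the Stirling correction and for
   ln(L_n / n). [K] collects all constants of the final comparison. *)
pose C1 := - ln (1 - beta) - ln (1 - (1 - beta)) + 1.
pose C2 := ln (ln (hs_delta beta)) + 1.
pose K := (C2 / ln 2 + 1) * ln (hs_gamma beta) + 2^-1 * C1 + 1.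
have /cvgryPge omega_ge := womega.
apply: (@squeeze_cvgr _ _ _ _ (cst 0) (fun n => expR K * (omega n)^-1)).
- near=> n.
  apply/andP; split; first by rewrite mulr_ge0 ?expR_ge0.
  have w0 : 0 < omega n by apply: (@lt_le_trans _ _ 1) => //; near: n; exact: omega_ge.
  have n0 : 0 < n%:R :> R by rewrite ltr0n; near: n; exact: near_nat_ge.
  have kn' : (0 < hs_k beta omega n < n)%N by near: n.
  have L1 : 1 <= hs_L beta omega n by near: n; exact: near_hs_L_ge.
  have L0 : 0 < hs_L beta omega n by lra.
  have [_ /andP[kT1 kT2]] : (hs_k beta omega n)%:Z = Num.floor (hs_threshold beta omega n)
    /\ hs_threshold beta omega n - 1 < (hs_k beta omega n)%:R <= hs_threshold beta omega n.
    by near: n; exact: near_hs_k_floor.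
  have LC2 : ln (hs_L beta omega n / n%:R) < C2.
    near: n; apply: (cvgr_lt (ln (ln (hs_delta beta)))); last by rewrite ltrDl.
    exact: (continuous_cvg _ (continuous_ln D0)).
  have rC1 : ln n%:R + (ln n%:R - ln (hs_k beta omega n)%:R
                        - ln (n - hs_k beta omega n)%:R) < C1.
    by near: n; apply: ratio_lt; rewrite /C1 ltrDl.
  (* As k is at most the threshold, 2^((1 - beta)n - k) is at least 2^(lg L_n) = L_n. *)
  have pL : hs_L beta omega n <= 2 `^ (- (n%:R * beta)) * 2 ^+ (n - hs_k beta omega n).
    case/andP: kn' => _ /ltnW kn'; rewrite mul_powR2_exp //.
    rewrite -{1}(powR2_lg L0) ler_powR ?ler1n //.
    by move: kT2; rewrite /hs_threshold; lra.
  have C0 : (0 : R) < 'C(n, hs_k beta omega n)%:R.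
    by case/andP: kn' => _ /ltnW ?; rewrite ltr0n bin_gt0.
  rewrite -{1}(@lnK _ 'C(n, hs_k beta omega n)%:R) ?posrE //.
  rewrite -(@lnK _ (omega n)) ?posrE // -expRN -!expRD ler_expR.
  have /andP[_] := ln_bin_bounds R kn'.
  (* At x = 1 - beta the bound equals n ln delta + ((1 - beta)n - k) ln((1 - beta)/beta). *)
  have := ln_entropy_le kn' b01'.
  have /andP[_ /ltnW kn''] := kn'.
  rewrite (natrB _ kn'') subKr.
  have g_ge0 : 0 <= ln (hs_gamma beta) by rewrite ln_ge0 // le_max lexx.
  have g_ge : ln (1 - beta) - ln beta <= ln (hs_gamma beta).
    rewrite -ln_div ?posrE // ler_ln ?posrE ?divr_gt0 ?le_max ?lexx ?orbT //.
    by rewrite lt_max ltr01.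
  have lgL_ge0 : 0 <= lg (hs_L beta omega n).
    by apply: divr_ge0; [exact: ln_ge0 | exact: ltW].
  have lgL_le : lg (hs_L beta omega n) <= lg n%:R + C2 / ln 2.
    rewrite /lg -mulrDl ler_pM2r ?invr_gt0 // -lerBlDl -ln_div ?posrE //.
    exact: ltW.
  move: pL kT1 kT2 rC1; rewrite /hs_threshold {1}/hs_L /K ln_hs_delta // (natrB _ kn'').
  clear kn' kn'' C0 L0 L1 LC2 w0.
  move: (hs_k beta omega n)%:R (lg (hs_L _ _ _)) lgL_ge0 lgL_le => k lgL.
  move: (ln (hs_gamma _)) g_ge0 g_ge (lg n%:R) (C2 / ln 2) => g g_ge0 g_ge lgn c.
  move: (ln (omega n)) (ln 'C(n, _)%:R) (ln_entropy _ _ _) (_ * _ ^+ _) => w lC H pX.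
  move=> lgL_ge0 lgL_le pL kT1 kT2 rC1 H_le lC_le.
  (* The shift (1 - beta)n - k lies between 0 and lg n + c + 1. Passing to ln gamma >= 0 first lets
     the upper end be used whatever the sign of ln((1 - beta)/beta). *)
  have dg : ((1 - beta) * n%:R - k) * (ln (1 - beta) - ln beta) <=
            (lgn + c + 1) * g.
    apply: (@le_trans _ _ (((1 - beta) * n%:R - k) * g)).
      by rewrite ler_wpM2l //; lra.
    by rewrite ler_wpM2r //; lra.
  move: rC1 pL H_le lC_le dg.
  by move: (C1) => *; lra.
- exact: cvg_cst.
- rewrite -[X in _ --> X](mulr0 (expR K)); apply: cvgMl_tmp.
  apply/gtr0_cvgV0 => //.
  by near=> n; apply: (@lt_le_trans _ _ 1) => //; near: n; exact: omega_ge.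
Unshelve. all: by end_near. Qed.

(** * Second moment at size h + 1 *)

Lemma invX_1B_le (R : realType) (p : R) (N : nat) : 0 <= p <= 6^-1 ->
  (1 - p) ^- N <= expR (6 / 5 * (p * N%:R)).
Proof.
move=> /andP[p0 p1]; have q0 : 0 < 1 - p by lra.
rewrite mulrA expRM_natr -exprVn lerXn2r ?nnegrE ?invr_ge0 ?expR_ge0 ?(ltW q0) //.
rewrite -[_^-1]mul1r ler_pdivrMr //.
(* The product is 1 + p/5 - 6p^2/5, at least 1 because p <= 1/6. *)
apply: (@le_trans _ _ ((1 + 6 / 5 * p) * (1 - p))); first by nra.
by rewrite ler_wpM2r ?(ltW q0) // expR_ge1Dx.
Qed.

Lemma up_log2_le (R : realType) (n : nat) : (1 < n)%N ->
  (up_log 2 n)%:R <= (ln n%:R + ln 2) / ln 2 :> R.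
Proof.
move=> n1; have l20 := @ln2_gt0 R.
rewrite ler_pdivlMr //; have := up_log_gtn (ltnSn 1) n1.
have : (0 < up_log 2 n)%N by rewrite up_log_gt0 n1.
case: up_log => // u _; rewrite /= -(ltr_nat R) natrX => /ltW.
rewrite -ler_ln ?posrE ?exprn_gt0 ?ltr0n ?(ltnW n1) // lnXn // -natr1.
by rewrite -mulr_natl; lra.
Qed.

Lemma near_powR2_le (R : realType) (beta e : R) : 0 < beta -> 0 < e ->
  \forall n \near \oo, 2 `^ (- (n%:R * beta)) <= e.
Proof.
move=> b0 e0; have l20 := @ln2_gt0 R.
have /cvgryPge/(_ (- ln e / (beta * ln 2))) := @cvgr_idn R.
apply: filterS => n; rewrite ler_pdivrMr ?mulr_gt0 // => en.
rewrite /powR pnatr_eq0 /= -[leRHS]lnK ?posrE // ler_expR.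
by rewrite mulNr lerNl -mulrA.
Qed.

Lemma cvg_second_moment (R : realType) (beta : R) (omega : nat -> R) :
  0 < beta < 1 ->
  ((fun n : nat => ln (omega n)) =o_\oo (fun n : nat => n%:R : R)) ->
  set_system_prob (2 `^ (- (n%:R * beta)))
    (fun A : {set {set 'I_n}} =>
       ~~ [exists S, hitting_set A S && (#|S| == (hs_k beta omega n).+2)])
  @[n --> \oo] --> (0 : R).
Proof.
move=> b01 lno; have D0 := ln_hs_delta_gt0 b01.
have cL := @cvg_hs_L_div _ beta omega lno; have ck := cvg_hs_k_div b01 lno.
have /andP[b0 b1] := b01; have b01' : 0 < 1 - beta < 1 by lra.
have l20 := @ln2_gt0 R.
set D := ln (hs_delta beta) in D0 cL *.
(* The fractions of [D] balance the exponent for close pairs, per unit of n: 1/10 for their count,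
   -9/10 for the binomial and (6/5)(7/6)/2 = 7/10 for the correlation leave -1/10. *)
have D1 : 0 < D / 10 by lra.
have D2 : D < 7 / 6 * D by lra.
have D3 : D < 2 * D by lra.
pose s n := (hs_k beta omega n).+2.
have cs : (s n)%:R / n%:R @[n --> \oo] --> (1 - beta : R).
  apply: (@near_cvg_eq _ (fun n => (hs_k beta omega n)%:R / n%:R + 2 * n%:R^-1)).
    by near=> n; rewrite /s -[(hs_k _ _ _).+2]addn2 natrD -mulrDl.
  rewrite -[X in _ --> X]addr0 -[X in _ + X](mulr0 2); apply: cvgD => //.
  by apply: cvgMl_tmp; exact: cvg_invn.
have sn := near_proportional b01' cs.
have /cvgr_gt C_gt := cvg_ln_bin_div b01' cs.
have {}C_gt : \forall n \near \oo, 9 / 10 * D < ln 'C(n, s n)%:R / n%:R.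
  apply: C_gt; rewrite subKr /D ln_hs_delta //.
  by move: D0; rewrite /D ln_hs_delta //; lra.
(* [q] bounds the logarithm of the number of sets close to a given one. *)
pose q n : R := 4 * (ln n%:R + ln 2) ^+ 2 / ln 2.
have cq : q n / n%:R @[n --> \oo] --> (0 : R).
  apply: (@near_cvg_eq _ (fun n => 4 / ln 2 * (ln n%:R ^+ 2 / n%:R)
    + 8 * (ln n%:R / n%:R) + 4 * ln 2 * n%:R^-1)).
    near=> n; have n0 : 0 < n%:R :> R by rewrite ltr0n; near: n; exact: near_nat_ge.
    by rewrite /q; field; rewrite !gt_eqF.
  rewrite -[X in _ --> X]addr0 -[X in _ + X](mulr0 (4 * ln 2)); apply: cvgD.
    rewrite -[X in _ --> X]addr0 -[X in _ + X](mulr0 8); apply: cvgD.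
      rewrite -[X in _ --> X](mulr0 (4 / ln 2)); apply: cvgMl_tmp.
      exact: cvg_sqr_ln_div.
    by apply: cvgMl_tmp; exact: cvg_ln_div.
  by apply: cvgMl_tmp; exact: cvg_invn.
have cu : 2 * (ln n%:R + ln 2) / ln 2 / n%:R @[n --> \oo] --> (0 : R).
  apply: (@near_cvg_eq _ (fun n => 2 / ln 2 * (ln n%:R / n%:R) + 2 * n%:R^-1)).
    near=> n; have n0 : 0 < n%:R :> R by rewrite ltr0n; near: n; exact: near_nat_ge.
    by field; rewrite !gt_eqF.
  rewrite -[X in _ --> X]addr0 -[X in _ + X](mulr0 2); apply: cvgD.
    rewrite -[X in _ --> X](mulr0 (2 / ln 2)); apply: cvgMl_tmp; exact: cvg_ln_div.
  by apply: cvgMl_tmp; exact: cvg_invn.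
apply: (@squeeze_cvgr _ _ _ _ (cst 0)
  (fun n => expR (- (n%:R * (D / 10))) + (expR (2 * D * n%:R^-1) - 1))).
- near=> n.
  have p16 : 0 <= 2 `^ (- (n%:R * beta)) <= 6^-1.
    rewrite powR_ge0 /=; near: n; exact: near_powR2_le.
  set p := 2 `^ _ in p16 *.
  have /andP[p0 p1] := p16; have p01 : 0 <= p < 1 by lra.
  have q0 : 0 <= 1 - p by lra.
  apply/andP; split.
    by apply: sumr_ge0 => A _; apply: set_system_weight_ge0; lra.
  have n1 : (1 < n)%N by near: n; exact: near_nat_ge.
  have n0 : 0 < n%:R :> R by rewrite ltr0n ltnW.
  have /andP[s0 sn'] : (0 < s n < n)%N by near: n.
  have L0 : 0 < hs_L beta omega n by near: n; exact: near_hs_L_gt0.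
  have [_ /andP[kT1 kT2]] : (hs_k beta omega n)%:Z = Num.floor (hs_threshold beta omega n)
    /\ hs_threshold beta omega n - 1 < (hs_k beta omega n)%:R <= hs_threshold beta omega n.
    by near: n; exact: near_hs_k_floor.
  (* The cutoff between close and far pairs: large enough for 2^i >= n^2, yet only logarithmic in
     n. *)
  pose i := (2 * up_log 2 n)%N.
  have i_le : i%:R <= 2 * (ln n%:R + ln 2) / ln 2 :> R.
    by rewrite /i natrM -mulrA ler_wpM2l // up_log2_le.
  have i_m : (i <= n - s n)%N.
    rewrite -(ler_nat R) natrB ?(ltnW sn') //; apply: le_trans i_le _.
    have sb : (s n)%:R / n%:R < 1 - beta / 2 :> R.
      by near: n; apply: (cvgr_lt _ cs); lra.
    have ub : 2 * (ln n%:R + ln 2) / ln 2 / n%:R < beta / 2 :> R.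
      by near: n; apply: (cvgr_lt _ cu); lra.
    move: sb; rewrite ltr_pdivrMr // => sb; move: ub; rewrite ltr_pdivrMr //.
    by move: (_ / ln 2) ((s n)%:R) sb => u x ? ?; lra.
  have i_ge : n%:R ^+ 2 <= 2 ^+ i :> R.
    rewrite /i mulnC exprM lerXn2r ?nnegrE ?exprn_ge0 ?ler0n //.
    by rewrite -natrX ler_nat up_logP.
  have C0 : (0 : R) < 'C(n, s n)%:R by rewrite ltr0n bin_gt0 ltnW.
  (* The size k + 2 exceeds the threshold by more than 1, which halves L_n. *)
  have pL : p * 2 ^+ (n - s n) <= hs_L beta omega n / 2.
    rewrite mul_powR2_exp ?(ltnW sn') //.
    have -> : hs_L beta omega n / 2 = 2 `^ (lg (hs_L beta omega n) - 1).
      by rewrite powRB ?pnatr_eq0 ?implybT // powR2_lg // powRr1.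
    rewrite ler_powR ?ler1n //.
    by move: kT1; rewrite /hs_threshold /s -[(hs_k _ _ _).+2]addn2 natrD; lra.
  apply: le_trans (second_moment_hitting i p01 (ltnW sn')) _.
  apply: lerD.
    apply: (@le_trans _ _ (expR (q n) / 'C(n, s n)%:R
                           * expR (6 / 5 * (hs_L beta omega n / 2)))).
      rewrite ler_pM ?mulr_ge0 ?invr_ge0 ?exprn_ge0 ?ler0n //.
        rewrite ler_wpM2r ?invr_ge0 ?ler0n //.
        rewrite natrX -[X in X ^+ _]lnK ?posrE ?ltr0n // -expRM_natl ler_expR.
        have ln1 : 0 <= ln n.+1%:R :> R by rewrite ln_ge0 // ler1n.
        have ln2' : ln n.+1%:R <= ln n%:R + ln 2 :> R.
          rewrite -lnM ?posrE // ler_ln ?posrE ?mulr_gt0 // -natrM ler_nat muln2.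
          by rewrite -addnn -addn1 leq_add2l ltnW.
        apply: (@le_trans _ _ ((2 * i)%:R * (ln n%:R + ln 2))).
          by rewrite ler_wpM2l.
        have -> : q n = 2 * (2 * (ln n%:R + ln 2) / ln 2) * (ln n%:R + ln 2).
          by rewrite /q; field; rewrite gt_eqF.
        rewrite ler_wpM2r ?(le_trans ln1) // natrM ler_wpM2l //.
      apply: le_trans (invX_1B_le _ p16) _; rewrite ler_expR ler_wpM2l //.
      by rewrite natrX.
    rewrite -{1}(@lnK _ 'C(n, s n)%:R) ?posrE // -expRN -!expRD ler_expR.
    have qn : q n / n%:R < D / 10 by near: n; exact: cvgr_lt cq _ D1.
    have Ln : hs_L beta omega n / n%:R < 7 / 6 * D.
      by near: n; exact: cvgr_lt cL _ D2.
    have Cn : 9 / 10 * D < ln 'C(n, s n)%:R / n%:R by near: n.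
    move: qn; rewrite ltr_pdivrMr // => qn; move: Ln; rewrite ltr_pdivrMr // => Ln.
    move: Cn; rewrite ltr_pdivlMr //; clear pL.
    by move: (ln 'C(_, _)%:R) (q n) (hs_L _ _ _) qn Ln => x y z *; lra.
  (* Far pairs: p 2^(n - s - i) <= L_n / (2 n^2) < D / n, and the factor 6/5 is below 2. *)
  rewrite lerB // (le_trans (invX_1B_le _ p16)) // ler_expR.
  have Ln : hs_L beta omega n / n%:R < 2 * D.
    by near: n; exact: cvgr_lt cL _ D3.
  have pN : p * (2 ^ (n - s n - i))%:R * n%:R ^+ 2 <= hs_L beta omega n / 2.
    apply: le_trans pL; rewrite -mulrA ler_wpM2l ?powR_ge0 //.
    rewrite -[in leRHS](subnK i_m) exprD natrX ler_wpM2l ?exprn_ge0 //.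
  move: (p * _) pN => y pN; rewrite ler_pdivlMr // -(ler_pM2r n0).
  move: Ln; rewrite ltr_pdivrMr //; move: (hs_L _ _ _) pN => L pN Ln.
  have n1' : 1 <= n%:R :> R by rewrite ler1n ltnW.
  by clear pL i_ge i_le; nra.
- exact: cvg_cst.
- rewrite -[X in _ --> X]addr0; apply: cvgD.
    have cD : n%:R * (D / 10) @[n --> \oo] --> +oo.
      apply: (cvg_comp _ (fun x : R => x * (D / 10)) (@cvgr_idn R)).
      by apply: (@gt0_cvgMly R +oo _ (D / 10) id) => //; exact: cvg_id.
    exact: (cvg_comp _ _ cD (@cvgr_expR R)).
  rewrite -[X in _ --> X](subrr 1); apply: cvgB; last exact: cvg_cst.
  rewrite -[X in _ --> X]expR0; apply: (continuous_cvg _ (@continuous_expR R 0)).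
  rewrite -[X in _ --> X](mulr0 (2 * D)); apply: cvgMl_tmp; exact: cvg_invn.
Unshelve. all: by end_near. Qed.

(** * Concentration on the two values h and h + 1 *)

Theorem theorem2 (R : realType) (beta : R) (omega : nat -> R)
  (beta_gt0 : 0 < beta) (beta_lt1 : beta < 1)
  (omega_infty : omega n @[n --> \oo] --> +oo)
  (ln_omega_o : (fun n : nat => ln (omega n)) =o_\oo (fun n : nat => n%:R : R)) :
  (hs_o beta omega n @[n --> \oo] --> (0 : R)) /\
  (set_system_prob (2 `^ (- (n%:R * beta)))
     (fun A : {set {set 'I_n}} =>
        min_hitting_size A (hs_h beta omega n) ||
        min_hitting_size A (hs_h beta omega n + 1))
   @[n --> \oo] --> (1 : R)).
Proof.
have b01 : 0 < beta < 1 by rewrite beta_gt0.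
have b01' : 0 < 1 - beta < 1 by lra.
split; first exact: cvg_hs_o.
have few := cvg_first_moment b01 omega_infty ln_omega_o.
have many := cvg_second_moment b01 ln_omega_o.
(* The probability is squeezed between 1 and 1 minus the first-moment bound at h - 1 minus the
   failure probability at h + 1. *)
apply: (squeeze_cvgr _ _ (@cvg_cst _ (1 : R) _ _ _)); last first.
  rewrite -[X in _ --> X]subr0 -[X in X - _]subr0.
  exact: cvgB (cvgB (@cvg_cst _ (1 : R) _ _ _) few) many.
near=> n.
have p16 : 0 <= 2 `^ (- (n%:R * beta)) <= 6^-1.
  by rewrite powR_ge0 /=; near: n; exact: near_powR2_le.
have p01 : 0 <= 2 `^ (- (n%:R * beta)) < 1 by case/andP: p16 => ? ?; lra.
have p01' : 0 <= 2 `^ (- (n%:R * beta)) <= 1 by case/andP: p16 => ? ?; lra.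
rewrite set_system_prob_le1 // andbT.
have /andP[_ /ltnW kn] : (0 < hs_k beta omega n < n)%N.
  by near: n; exact: near_proportional (cvg_hs_k_div b01 ln_omega_o).
have [kE _] : (hs_k beta omega n)%:Z = Num.floor (hs_threshold beta omega n)
  /\ hs_threshold beta omega n - 1 < (hs_k beta omega n)%:R
     <= hs_threshold beta omega n.
  by near: n; exact: near_hs_k_floor.
have -> : hs_h beta omega n = (hs_k beta omega n)%:Z + 1.
  rewrite kE /hs_h /hs_o -/(hs_L beta omega n) /hs_threshold.
  by rewrite opprB addrA subrK.
apply: le_trans (set_system_prob_min_hitting_size p01' kn).
by rewrite /= lerD2r lerD2l lerN2 set_system_prob_hitting_size.
Unshelve. all: by end_near. Qed.
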